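(* Let $P \in \mathcal P(\mathbb S^{d-1})$ and $x \in \mathbb S^{d-1}$ be such that $P(\mathbb S^{d-1}_0) = 0$ and $x \in \mathbb S^{d-1}_+$. Then $$\mathrm{ahD}(x;P) = P\left(\mathbb S^{d-1}_-\right) + \inf \left\{ P_+(H) - P_-(H^\circ) : H \in \mathcal H^* \text{ and } \xi(x) \in H \right\},$$ where $\mathcal H^*$ is the set of all generalized halfspaces in $\mathbb R^{d-1}$. If, in addition, $$P\left(\partial H \cap \mathbb S^{d-1}_-\right) = 0 \quad \text{for all } H \in \mathcal H_0,$$ then $$\mathrm{ahD}(x;P) = P(\mathbb S^{d-1}_-) + \mathrm{hD}(\xi(x); P_{\pm}).$$
   Context: Let $d \ge 2$ be an integer, $\mathbb S^{d-1} = \{x \in \mathbb R^d : \|x\| = 1\}$, and let $\mathcal P(\mathbb S^{d-1})$ be the set of Borel probability measures on $\mathbb S^{d-1}$. For a Borel set $A \subseteq \mathbb R^d$ and $P \in \mathcal P(\mathbb S^{d-1})$, write $P(A) = P(A \cap \mathbb S^{d-1})$. For $u \in \mathbb S^{d-1}$ let $H_{0,u} = \{y \in \mathbb R^d : \langle y,u\rangle \ge 0\}$ and $\mathcal H_0 = \{H_{0,u} : u \in \mathbb S^{d-1}\}$; $\partial H$ is the topological boundary of $H$. The angular halfspace depth is $$\mathrm{ahD}(x;P) = \inf\{P(H_{0,u}) : u \in \mathbb S^{d-1},\ x \in H_{0,u}\}.$$ Let $e_d = (0,\dots,0,1)^{\mathsf T}$, $\mathbb S^{d-1}_+ = \{y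 \in \mathbb S^{d-1} : \langle y,e_d\rangle > 0\}$, $\mathbb S^{d-1}_- = \{y \in \mathbb S^{d-1}: \langle y,e_d\rangle < 0\}$, $\mathbb S^{d-1}_0 = \{y \in \mathbb S^{d-1}: \langle y,e_d\rangle = 0\}$. The gnomonic projection is the map $\xi(x) = x/\langle x,e_d\rangle$ from $\mathbb S^{d-1}\setminus \mathbb S^{d-1}_0$ to the hyperplane $\{y \in \mathbb R^d : \langle y,e_d\rangle = 1\}$; this hyperplane is identified with $\mathbb R^{d-1}$ by dropping the last coordinate (equal to $1$), so that $\xi(x) \in \mathbb R^{d-1}$. For Borel $B \subseteq \mathbb R^{d-1}$ put $$P_+(B) = P(\{y \in \mathbb S^{d-1}_+ : \xi(y) \in B\}),\quad P_-(B) = P(\{y \in \mathbb S^{d-1}_- : \xi(y) \in B\}),\quad P_\pm(B) = P_+(B) - P_-(B).$$ A generalized halfspace in $\mathbb R^{d-1}$ is a closed halfspace of $\mathbb R^{d-1}$, the empty set, or the whole space $\mathbb R^{d-1}$. $H^\circ$ denotes the interior of $H$ in $\mathbb R^{d-1}$. For a finite signed Borel measure $Q$ on $\mathbb R^{d-1}$ and $z \in \mathbb R^{d-1}$, the halfspace depth is $\mathrm{hD}(z;Q) = \inf\{Q(H) : H \text{ a closed halfspace in } \mathbb R^{d-1},\ z \in H\}$. *)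

(* Defs.v *)
From HB Require Import structures.
From mathcomp Require Import all_boot all_order all_algebra.
From mathcomp Require Import all_classical all_reals all_analysis.

Set Implicit Arguments.
Unset Strict Implicit.
Unset Printing Implicit Defensive.

Import Order.TTheory GRing.Theory Num.Theory.
Import numFieldNormedType.Exports.

Local Open Scope classical_set_scope.
Local Open Scope ring_scope.

Notation borel T := (g_sigma_algebraType (@open T)).

Definition boundary (T : topologicalType) (A : set T) : set T :=
  closure A `\` interior A.

Section Euclidean.
Context {R : realType} {k : nat}.
Implicit Types x y u : 'rV[R]_k.

(* The library norm on ['rV_k] is the sup norm, hence these definitions; the
   topology of ['rV_k] is the usual one. *)
Definition dot x y : R := \sum_(i < k) x 0 i * y 0 i.
Definition enorm x : R := Num.sqrt (dot x x).
Definition sphere : set 'rV[R]_k := [set x | enorm x = 1].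

Definition is_halfspace (H : set 'rV[R]_k) : Prop :=
  exists u (c : R), u != 0 /\ H = [set y | c <= dot y u].

Definition is_generalized_halfspace (H : set 'rV[R]_k) : Prop :=
  [\/ is_halfspace H, H = set0 | H = setT].

Definition halfspace0 u : set 'rV[R]_k := [set y | 0 <= dot y u].

Definition is_halfspace0 (H : set 'rV[R]_k) : Prop :=
  exists2 u, sphere u & H = halfspace0 u.

End Euclidean.
Arguments sphere : clear implicits.

Section Halfspace_depth.
Context {R : realType} {k : nat}.
Local Open Scope ereal_scope.

Definition hD (z : 'rV[R]_k) (Q : {charge set (borel 'rV[R]_k) -> \bar R}) :
    \bar R :=
  ereal_inf [set Q H | H in [set H | is_halfspace H /\ H z]].

End Halfspace_depth.

(* From here on the ambient dimension is [d = n.+1], so that [n = d - 1]. *)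

Section Sphere_type.
Context (R : realType) (n : nat).

Definition e_d : 'rV[R]_n.+1 := delta_mx 0 ord_max.

Lemma dot_e_d (y : 'rV[R]_n.+1) : dot y e_d = y 0 ord_max.
Proof.
rewrite /dot (bigD1 ord_max) //= mxE !eqxx mulr1 big1 ?addr0 // => i ni.
by rewrite mxE eqxx (negbTE ni) mulr0.
Qed.

Lemma sphere_e_d : sphere R n.+1 e_d.
Proof. by rewrite /sphere /= /enorm dot_e_d mxE !eqxx sqrtr1. Qed.

(* [set_type] carries the topology induced by the inclusion. *)
Definition sphere_type := set_type (sphere R n.+1).
HB.instance Definition _ := Topological.on sphere_type.
HB.instance Definition _ := isPointed.Build sphere_type
  (exist _ e_d (mem_set sphere_e_d)).

Definition S_pos : set 'rV[R]_n.+1 := sphere R n.+1 `&` [set y | 0 < dot y e_d].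
Definition S_neg : set 'rV[R]_n.+1 := sphere R n.+1 `&` [set y | dot y e_d < 0].
Definition S_zero : set 'rV[R]_n.+1 := sphere R n.+1 `&` [set y | dot y e_d = 0].

Definition drop_last (y : 'rV[R]_n.+1) : 'rV[R]_n :=
  \row_(j < n) y 0 (widen_ord (leqnSn n) j).

(* Only meaningful where [dot y e_d != 0]. *)
Definition gnomonic (y : 'rV[R]_n.+1) : 'rV[R]_n :=
  drop_last ((dot y e_d)^-1 *: y).

End Sphere_type.
Arguments e_d {R n}.
Arguments S_pos {R n}.
Arguments S_neg {R n}.
Arguments S_zero {R n}.

Section Angular_depth.
Context {R : realType} {n : nat}.
Variable P : probability (borel (sphere_type R n)) R.
Local Open Scope ereal_scope.

(* [P(A)] for [A] a subset of the ambient space, read as [P] of the trace of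
   [A] on the sphere. *)
Definition prob (A : set 'rV[R]_n.+1) : \bar R := P (set_val @^-1` A).

Definition ahD (x : 'rV[R]_n.+1) : \bar R :=
  ereal_inf [set prob (halfspace0 u) |
             u in [set u | sphere R n.+1 u /\ halfspace0 u x]].

Definition P_pos (B : set (borel 'rV[R]_n)) : \bar R :=
  prob (S_pos `&` @gnomonic R n @^-1` B).

Definition P_neg (B : set (borel 'rV[R]_n)) : \bar R :=
  prob (S_neg `&` @gnomonic R n @^-1` B).

End Angular_depth.

Section Projected_measures.
Context {R : realType} {n : nat}.
Variable P : probability (borel (sphere_type R n)) R.

Local Notation set_val := (set_val : sphere_type R n -> 'rV[R]_n.+1).

Lemma continuous_set_val : continuous set_val.
Proof. exact: initial_continuous. Qed.

Lemma continuous_dot_e_d : continuous (fun y : 'rV[R]_n.+1 => dot y e_d).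
Proof. by under eq_fun do rewrite dot_e_d; exact: coord_continuous. Qed.

Lemma continuous_gnomonic (y : 'rV[R]_n.+1) :
  dot y e_d != 0 -> {for y, continuous (@gnomonic R n)}.
Proof.
move=> y0 A [Q Qn QA].
have H i j : \forall z \near y, Q i j (gnomonic z i j).
  pose g (z : 'rV[R]_n.+1) := (dot z e_d)^-1 * z 0 (widen_ord (leqnSn n) j).
  have cg : {for y, continuous g}.
    apply: (@continuousM _ _ (fun z => (dot z e_d)^-1)
      (fun z => z 0 (widen_ord (leqnSn n) j))); last exact: coord_continuous.
    by apply: (@continuousV _ _ (fun z => dot z e_d)) => //;
      exact: continuous_dot_e_d.
  have gE z : gnomonic z i j = g z by rewrite ord1 !mxE.
  suff : nbhs y (g @^-1` Q i j) by apply: filterS => z; rewrite gE.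
  by apply: cg; rewrite -gE; exact: Qn.
have : \forall z \near y, forall ij, Q ij.1 ij.2 (gnomonic z ij.1 ij.2).
  have := @filter_forall _ ('I_1 * 'I_n)%type
    (fun ij z => Q ij.1 ij.2 (gnomonic z ij.1 ij.2)) (nbhs y) _.
  by apply=> -[i j]; exact: H.
by apply: filterS => z Qz; apply: QA => i j; exact: (Qz (i, j)).
Qed.

Let measurable_part (D : set 'rV[R]_n.+1) (B : set (borel 'rV[R]_n)) :
  open D -> (forall y, D y -> dot y e_d != 0) -> measurable B ->
  measurable (set_val @^-1` (D `&` @gnomonic R n @^-1` B)
              : set (borel (sphere_type R n))).
Proof.
move=> oD D0 mB.
have oE : open (set_val @^-1` D).
  by move/continuousP: continuous_set_val; apply.
have mE : measurable (set_val @^-1` D : set (borel (sphere_type R n))).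
  exact: sub_sigma_algebra.
suff : measurable_fun (set_val @^-1` D : set (borel (sphere_type R n)))
         (@gnomonic R n \o set_val : _ -> borel 'rV[R]_n).
  by move=> /(_ mE _ mB).
apply: (@measurability _ _ (borel (sphere_type R n)) (borel 'rV[R]_n) _ _
  (@open 'rV[R]_n)) => // _ [C oC <-].
apply: sub_sigma_algebra; rewrite openE => y [Dy Cy]; apply: filterI.
  exact: open_nbhs_nbhs.
have /= := continuous_comp (@continuous_set_val y)
  (continuous_gnomonic (D0 _ Dy)).
by apply; exact: open_nbhs_nbhs.
Qed.

Let open_upper : open [set y : 'rV[R]_n.+1 | 0 < dot y e_d].
Proof. exact: (proj1 (continuousP _) continuous_dot_e_d _ (@open_gt _ 0)). Qed.

Let open_lower : open [set y : 'rV[R]_n.+1 | dot y e_d < 0].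
Proof. exact: (proj1 (continuousP _) continuous_dot_e_d _ (@open_lt _ 0)). Qed.

Let sphere_trace (D : set 'rV[R]_n.+1) (B : set 'rV[R]_n) :
  set_val @^-1` (sphere R n.+1 `&` D `&` @gnomonic R n @^-1` B) =
  set_val @^-1` (D `&` @gnomonic R n @^-1` B).
Proof.
apply/seteqP; split=> y; first by move=> [[_ Dy] By].
by move=> [Dy By]; do 2?split => //; exact: set_valP.
Qed.

Let measurable_pos (B : set (borel 'rV[R]_n)) : measurable B ->
  measurable (set_val @^-1` (S_pos `&` @gnomonic R n @^-1` B)
              : set (borel (sphere_type R n))).
Proof.
move=> mB; rewrite sphere_trace; apply: measurable_part => // y.
exact: lt0r_neq0.
Qed.

Let measurable_neg (B : set (borel 'rV[R]_n)) : measurable B ->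
  measurable (set_val @^-1` (S_neg `&` @gnomonic R n @^-1` B)
              : set (borel (sphere_type R n))).
Proof.
move=> mB; rewrite sphere_trace; apply: measurable_part => // y.
exact: ltr0_neq0.
Qed.

Local Open Scope ereal_scope.

Let part_additive (S : set 'rV[R]_n.+1) :
  (forall B : set (borel 'rV[R]_n), measurable B ->
   measurable (set_val @^-1` (S `&` @gnomonic R n @^-1` B)
              : set (borel (sphere_type R n)))) ->
  semi_sigma_additive (fun B : set (borel 'rV[R]_n) =>
    prob P (S `&` @gnomonic R n @^-1` B)).
Proof.
move=> mS F mF tF mUF; rewrite /prob preimage_bigcup setI_bigcupr.
rewrite preimage_bigcup.
apply: measure_semi_sigma_additive.
- by move=> i; exact: mS.
- apply/trivIsetP => i j _ _ ij; move/trivIsetP : tF => /(_ i j I I ij) Fij.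
  apply/seteqP; split=> // y [[_ Fi] [_ Fj]].
  by have : (F i `&` F j) (gnomonic (set_val y)); [split|rewrite Fij].
- by rewrite -preimage_bigcup -setI_bigcupr -preimage_bigcup; exact: mS.
Qed.

Let P_pos0 : P_pos P set0 = 0.
Proof. by rewrite /P_pos /prob preimage_set0 setI0 preimage_set0 measure0. Qed.

Let P_neg0 : P_neg P set0 = 0.
Proof. by rewrite /P_neg /prob preimage_set0 setI0 preimage_set0 measure0. Qed.

Let P_pos_fin B : measurable B -> P_pos P B \is a fin_num.
Proof. by move=> mB; apply: fin_num_measure; exact: measurable_pos. Qed.

Let P_neg_fin B : measurable B -> P_neg P B \is a fin_num.
Proof. by move=> mB; apply: fin_num_measure; exact: measurable_neg. Qed.

HB.instance Definition _ := isCharge.Build _ _ _ (P_pos P)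
  P_pos0 P_pos_fin (part_additive measurable_pos).

HB.instance Definition _ := isCharge.Build _ _ _ (P_neg P)
  P_neg0 P_neg_fin (part_additive measurable_neg).

Definition P_pm (B : set (borel 'rV[R]_n)) : \bar R := P_pos P B - P_neg P B.

HB.instance Definition _ := Charge.copy P_pm (cadd (P_pos P) (copp (P_neg P))).

End Projected_measures.

(* Main.v *)
Require Import Defs.
From mathcomp Require Import all_boot all_order all_algebra.
From mathcomp Require Import all_classical all_reals all_analysis.

Import Order.TTheory GRing.Theory Num.Theory.
Import numFieldNormedType.Exports.

Local Open Scope classical_set_scope.
Local Open Scope ereal_scope.

(** Let [u] be a unit vector and write [v] for its first [n] coordinates and
    [c] for the last one. For a point [y] of the sphere off the equator,
    [dot y u = dot y e_d * (dot (gnomonic y) v + c)]. So on the upper hemisphere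
    [0 <= dot y u] says that the gnomonic projection of [y] lies in
    [cut u = {z | - c <= dot z v}], while on the lower hemisphere, where
    [dot y e_d] is negative, it says that this projection does not lie in the
    interior of [cut u]. As the equator is negligible, the probability of the
    closed halfspace of normal [u] is
    [P(S_neg) + P_pos (cut u) - P_neg (interior (cut u))] ([prob_halfspace0]).
    The sets [cut u] are exactly the generalized halfspaces ([cut_generalized],
    [generalized_halfspace_cut]): the normals [e_d] and [- e_d] give the whole
    space and the empty set. Since [x] lies in the upper hemisphere, the
    halfspace of normal [u] contains [x] iff [cut u] contains its projection.
    The angular depth of [x] and the infimum over generalized halfspaces are
    therefore infima of the same numbers, up to the constant [P(S_neg)].

    If boundaries of halfspaces carry no mass in the lower hemisphere, [P_neg]
    does not distinguish [cut u] from its interior ([P_neg_interior_cut]), and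
    the numbers are values of the signed measure. It remains to drop the
    improper halfspaces from the infimum. The empty set contains no point, and
    the whole space is approached by an increasing sequence of closed halfspaces
    that eventually contain the given point ([hD_le_setT]). *)

(** * Scalar products and halfspaces *)

Section Dot.
Local Open Scope ring_scope.
Context {R : realType} {k : nat}.
Implicit Types x y u : 'rV[R]_k.

Lemma dotBl x y u : dot (x - y) u = dot x u - dot y u.
Proof.
by rewrite /dot -sumrB; apply: eq_bigr => i _; rewrite !mxE mulrBl.
Qed.

Lemma dotZl (t : R) x u : dot (t *: x) u = t * dot x u.
Proof.
by rewrite /dot mulr_sumr; apply: eq_bigr => i _; rewrite mxE mulrA.
Qed.

Lemma dotZr (t : R) x u : dot x (t *: u) = t * dot x u.
Proof.
by rewrite /dot mulr_sumr; apply: eq_bigr => i _; rewrite mxE mulrCA.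
Qed.

Lemma dot0r x : dot x 0 = 0.
Proof. by rewrite -(scale0r (0 : 'rV[R]_k)) dotZr mul0r. Qed.

Lemma dot_gt0 u : u != 0 -> 0 < dot u u.
Proof.
move=> u0; rewrite lt0r sumr_ge0 ?andbT; last first.
  by move=> i _; rewrite -expr2 sqr_ge0.
apply: contra u0 => /eqP uu0; apply/eqP/rowP => i; rewrite mxE.
apply/eqP; rewrite -sqrf_eq0 expr2; apply/eqP.
by apply: (psumr_eq0P _ uu0) => // j _; rewrite -expr2 sqr_ge0.
Qed.

Lemma sphere_neq0 u : sphere R k u -> u != 0.
Proof.
apply: contraPneq => ->.
by rewrite /sphere /= /enorm dot0r sqrtr0 => /esym/eqP; rewrite oner_eq0.
Qed.

Lemma sphere_rescale u : u != 0 ->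
  exists2 t : R, 0 < t & sphere R k (t *: u).
Proof.
move=> u0; have uu := dot_gt0 _ u0.
have e0 : 0 < enorm u by rewrite sqrtr_gt0.
exists (enorm u)^-1; first by rewrite invr_gt0.
rewrite /sphere /= /enorm dotZl dotZr mulrA -expr2 sqrtrM ?sqr_ge0//.
by rewrite sqrtr_sqr ger0_norm ?invr_ge0 1?ltW// mulVf// gt_eqF.
Qed.

Lemma continuous_dot u : continuous (fun y => dot y u).
Proof.
move=> y; rewrite /continuous_at /dot.
apply: cvg_big; [exact: add_continuous|exact: nbhs_filter|].
move=> i _; apply: (@continuousM _ _ (fun y => y 0 i)).
  exact: coord_continuous.
exact: cst_continuous.
Qed.

Lemma open_halfspace u (c : R) : open [set y | c < dot y u].
Proof. exact: (proj1 (continuousP _) (continuous_dot u) _ (@open_gt _ c)). Qed.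

(** A point with [dot y u = c] leaves the halfspace when moved along [- u],
    however little, so it is not interior. *)
Lemma interior_halfspace u (c : R) : u != 0 ->
  interior [set y | c <= dot y u] = [set y | c < dot y u].
Proof.
move=> u0; apply/seteqP; split; last first.
  rewrite -open_subsetE; last exact: open_halfspace.
  by move=> y /= /ltW.
move=> y /= yI.
have cy : (fun t : R => y - t *: u) @ 0^'+ --> y.
  apply: cvg_at_right_filter.
  rewrite -[X in _ --> X](subr0 y); apply: cvgB; first exact: cvg_cst.
  by rewrite -[X in _ --> X](scale0r u); exact: scalel_continuous.
have yH : \forall t \near 0^'+, c <= dot (y - t *: u) u := cy _ yI.
have [t [/= cH t0]] := filter_ex (filterI yH (nbhs_right_gt (0 : R))).
rewrite dotBl dotZl lerBrDr in cH.
by apply: lt_le_trans cH; rewrite ltrDl mulr_gt0 // dot_gt0.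
Qed.

Lemma boundary_halfspace u (c : R) : u != 0 ->
  boundary [set y | c <= dot y u] = [set y | dot y u = c].
Proof.
move=> u0; rewrite /boundary interior_halfspace// -(proj1 (closure_id _)).
  apply/seteqP; split=> y /=; last by move=> ->; rewrite lexx ltxx.
  by move=> [cy /negP]; rewrite -leNgt => yc; apply/eqP; rewrite eq_le yc.
exact: (proj1 (continuous_closedP _) (continuous_dot u) _ (@closed_ge _ c)).
Qed.

Lemma bigcup_halfspace u :
  \bigcup_(m : nat) [set y | - m%:R <= dot y u] = setT.
Proof.
apply/seteqP; split=> // y _; exists (Num.truncn (- dot y u)).+1 => //=.
by rewrite lerNl ltW // truncnS_gt.
Qed.

End Dot.

(** * Halfspaces seen through the gnomonic projection *)

Section Gnomonic.
Local Open Scope ring_scope.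
Context {R : realType} {n : nat}.
Implicit Types (y u : 'rV[R]_n.+1) (z w : 'rV[R]_n).

Definition last_coord u : R := u 0 ord_max.

(** The homogeneous linear inequality [0 <= dot y u] becomes, in the chart
    [dot y e_d = 1], the affine inequality in [z] that defines this set. *)
Definition cut u : set 'rV[R]_n :=
  [set z | - last_coord u <= dot z (drop_last u)].

Definition open_cut u : set 'rV[R]_n :=
  [set z | - last_coord u < dot z (drop_last u)].

(** The minus sign makes [cut] recover the halfspace [c <= dot z w]. *)
Definition lift_halfspace w (c : R) : 'rV[R]_n.+1 :=
  \row_j (if unlift ord_max j is Some i then w 0 i else - c).

Lemma widen_ord_lift (i : 'I_n) : widen_ord (leqnSn n) i = lift ord_max i.
Proof. by apply: val_inj; rewrite /= /bump leqNgt ltn_ord. Qed.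

Lemma drop_last_lift w c : drop_last (lift_halfspace w c) = w.
Proof. by apply/rowP => i; rewrite !mxE widen_ord_lift liftK. Qed.

Lemma last_coord_lift w c : last_coord (lift_halfspace w c) = - c.
Proof. by rewrite /last_coord mxE unlift_none. Qed.

Lemma drop_lastZ (t : R) u : drop_last (t *: u) = t *: drop_last u.
Proof. by apply/rowP => i; rewrite !mxE. Qed.

Lemma last_coordZ (t : R) u : last_coord (t *: u) = t * last_coord u.
Proof. by rewrite /last_coord mxE. Qed.

Lemma dot_recr y u :
  dot y u = dot (drop_last y) (drop_last u) + last_coord y * last_coord u.
Proof.
rewrite /dot big_ord_recr /=; congr (_ + _).
by apply: eq_bigr => i _; rewrite !mxE.
Qed.

Lemma last_coord_neq0 u : drop_last u = 0 -> u != 0 -> last_coord u != 0.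
Proof.
move=> u0 un0; have := dot_gt0 _ un0.
by rewrite dot_recr u0 dot0r add0r; apply: contraTneq => ->; rewrite mul0r ltxx.
Qed.

Lemma cut_lift w c : cut (lift_halfspace w c) = [set z | c <= dot z w].
Proof. by rewrite /cut drop_last_lift last_coord_lift opprK. Qed.

Lemma cutZ (t : R) u : 0 < t -> cut (t *: u) = cut u.
Proof.
move=> t0; rewrite /cut drop_lastZ last_coordZ.
by apply/seteqP; split=> z /=; rewrite dotZr -mulrN ler_pM2l.
Qed.

(** When [drop_last u = 0] both cuts are given by a constant inequality, which
    is strict because [last_coord u != 0]. *)
Lemma interior_cut u : u != 0 -> interior (cut u) = open_cut u.
Proof.
move=> u0; have [v0|v0] := eqVneq (drop_last u) 0; last first.
  exact: interior_halfspace.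
have := last_coord_neq0 _ v0 u0.
have -> : open_cut u = if 0 < last_coord u then setT else set0.
  rewrite /open_cut v0; case: ifP => c0; apply/seteqP; split=> z //=;
    by rewrite dot0r oppr_lt0 c0.
have -> : cut u = if 0 <= last_coord u then setT else set0.
  rewrite /cut v0; case: ifP => c0; apply/seteqP; split=> z //=;
    by rewrite dot0r oppr_le0 c0.
by case: ltgtP => // _ _; rewrite (interiorT, interior0).
Qed.

Lemma cut_generalized u : is_generalized_halfspace (cut u).
Proof.
have [v0|v0] := eqVneq (drop_last u) 0; last first.
  by apply: Or31; exists (drop_last u), (- last_coord u).
have [c0|c0] := leP 0 (last_coord u); [apply: Or33|apply: Or32];
  apply/seteqP; split=> z //=; rewrite /cut /= v0 dot0r oppr_le0 //.
by rewrite leNgt c0.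
Qed.

Lemma drop_last_e_d : drop_last e_d = 0 :> 'rV[R]_n.
Proof.
apply/rowP => i; rewrite !mxE widen_ord_lift eq_sym.
by rewrite (negbTE (neq_lift _ _)) andbF.
Qed.

Lemma last_coord_e_d : last_coord e_d = 1.
Proof. by rewrite /last_coord mxE !eqxx. Qed.

(** The affine inequalities with zero linear part, that is [u = e_d] and
    [u = - e_d] up to scaling, account for the improper generalized
    halfspaces. *)
Lemma generalized_halfspace_cut (H : set 'rV[R]_n) :
  is_generalized_halfspace H -> exists2 u, sphere R n.+1 u & H = cut u.
Proof.
have rescale u : u != 0 -> H = cut u -> exists2 u, sphere R n.+1 u & H = cut u.
  move=> /sphere_rescale[t t0 tu] ->.
  by exists (t *: u) => //; rewrite cutZ.
have e0 : e_d != 0 :> 'rV[R]_n.+1 by apply/sphere_neq0/sphere_e_d.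
move=> [[w [c [w0 HE]]]|H0|HT].
- apply: (rescale (lift_halfspace w c)); last by rewrite HE cut_lift.
  apply: contra_neq w0 => l0.
  by rewrite -(drop_last_lift w c) l0 -(scale0r 0) drop_lastZ scale0r.
- apply: (rescale (-1 *: e_d)); first by rewrite scaleN1r oppr_eq0.
  rewrite H0; apply/seteqP; split=> z //; rewrite /cut /= drop_lastZ.
  rewrite last_coordZ drop_last_e_d scaler0 dot0r last_coord_e_d.
  by rewrite mulr1 opprK ler10.
- apply: (rescale e_d) => //; rewrite HT; apply/seteqP; split=> // z _.
  by rewrite /cut /= drop_last_e_d dot0r last_coord_e_d lerN10.
Qed.

Lemma dot_gnomonic y u : dot y e_d != 0 ->
  dot y u = dot y e_d * (dot (gnomonic y) (drop_last u) + last_coord u).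
Proof.
move=> y0; rewrite /gnomonic drop_lastZ dotZl mulrDr mulVKf//.
by rewrite dot_recr dot_e_d.
Qed.

Lemma cut_gnomonic_pos y u : 0 < dot y e_d ->
  cut u (gnomonic y) <-> 0 <= dot y u.
Proof.
move=> y0; rewrite (dot_gnomonic _ u) ?gt_eqF//.
by rewrite pmulr_rge0// /cut /= -lerBlDr sub0r.
Qed.

(** The gnomonic projection reverses the inequalities on the lower
    hemisphere. *)
Lemma cut_gnomonic_neg y u : dot y e_d < 0 ->
  cut u (gnomonic y) <-> dot y u <= 0.
Proof.
move=> y0; rewrite (dot_gnomonic _ u) ?lt_eqF//.
by rewrite nmulr_rle0// /cut /= -lerBlDr sub0r.
Qed.

Lemma open_cut_gnomonic_neg y u : dot y e_d < 0 ->
  open_cut u (gnomonic y) <-> dot y u < 0.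
Proof.
move=> y0; rewrite (dot_gnomonic _ u) ?lt_eqF//.
by rewrite nmulr_rlt0// /open_cut /= -ltrBlDr sub0r.
Qed.

End Gnomonic.

(** * Depths *)

Lemma ereal_inf_addl (R : realType) (T : Type) (A : set T) (f : T -> \bar R)
    (c : \bar R) : c \is a fin_num ->
  ereal_inf [set c + f x | x in A] = c + ereal_inf [set f x | x in A].
Proof.
move=> cfin; apply/eqP; rewrite eq_le; apply/andP; split.
  rewrite -leeBlDl//; apply: le_ereal_inf_tmp => _ [x Ax <-].
  by rewrite leeBlDl//; apply: ereal_inf_lbound; exists x.
apply: le_ereal_inf_tmp => _ [x Ax <-].
by apply: leeD2l; apply: ereal_inf_lbound; exists x.
Qed.

Section Depth.
Context {R : realType} {n : nat}.
Variable P : probability (borel (sphere_type R n)) R.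
Implicit Types (u y : 'rV[R]_n.+1) (A : set 'rV[R]_n.+1).

Local Notation trace A :=
  (set_val @^-1` A : set (borel (sphere_type R n))).

Lemma trace_sphere A : trace (sphere R n.+1 `&` A) = trace A.
Proof.
apply/seteqP; split=> y; first by case.
by move=> Ay; split=> //; exact: set_valP.
Qed.

Lemma measurable_trace_open A : open A -> measurable (trace A).
Proof.
move=> oA; apply: sub_sigma_algebra.
exact: (proj1 (continuousP _) (@continuous_set_val R n)).
Qed.

Lemma measurable_trace_gt0 u : measurable (trace [set y | (0 < dot y u)%R]).
Proof. by apply: measurable_trace_open; exact: open_halfspace. Qed.

Lemma measurable_trace_lt0 u : measurable (trace [set y | (dot y u < 0)%R]).
Proof.
rewrite (_ : [set y | _] = [set y | (0 < dot y (-1 *: u))%R]).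
  exact: measurable_trace_gt0.
by apply/seteqP; split=> y /=; rewrite dotZr mulN1r oppr_gt0.
Qed.

Lemma measurable_trace_ge0 u : measurable (trace [set y | (0 <= dot y u)%R]).
Proof.
rewrite (_ : trace _ = ~` trace [set y | (dot y u < 0)%R]).
  by apply: measurableC; exact: measurable_trace_lt0.
by apply/seteqP; split=> y /=; rewrite leNgt => /negP.
Qed.

Lemma measurable_trace_le0 u : measurable (trace [set y | (dot y u <= 0)%R]).
Proof.
rewrite (_ : trace _ = ~` trace [set y | (0 < dot y u)%R]).
  by apply: measurableC; exact: measurable_trace_gt0.
by apply/seteqP; split=> y /=; rewrite leNgt => /negP.
Qed.

Lemma trace_S_neg : trace S_neg = trace [set y | (dot y e_d < 0)%R].
Proof. exact: trace_sphere. Qed.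

Lemma measurable_S_neg : measurable (trace S_neg).
Proof. by rewrite trace_S_neg; exact: measurable_trace_lt0. Qed.

Lemma prob_S_neg_fin : prob P S_neg \is a fin_num.
Proof. by apply: fin_num_measure; exact: measurable_S_neg. Qed.

Lemma trace_S_pos_cut u :
  trace (S_pos `&` @gnomonic R n @^-1` cut u) =
  trace [set y | (0 < dot y e_d)%R] `&` trace (halfspace0 u).
Proof.
rewrite preimage_setI trace_sphere; apply/seteqP; split=> y [/= y0];
  by move/(cut_gnomonic_pos _ _ y0); split.
Qed.

Lemma trace_S_neg_cut u :
  trace (S_neg `&` @gnomonic R n @^-1` cut u) =
  trace S_neg `&` trace [set y | (dot y u <= 0)%R].
Proof.
rewrite preimage_setI trace_S_neg; apply/seteqP; split=> y [/= y0];
  by move/(cut_gnomonic_neg _ _ y0); split.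
Qed.

Lemma trace_S_neg_open_cut u :
  trace (S_neg `&` @gnomonic R n @^-1` open_cut u) =
  trace S_neg `\` trace (halfspace0 u).
Proof.
rewrite preimage_setI trace_S_neg; apply/seteqP; split=> y [/= y0].
  by move/(open_cut_gnomonic_neg _ _ y0); rewrite ltNge => /negP; split.
move=> /negP; rewrite -ltNge => yu; split=> //.
exact/open_cut_gnomonic_neg.
Qed.

(** The closed halfspace of normal [u] meets the upper hemisphere in what the
    gnomonic projection sends to [cut u], and the lower one in the complement
    of what it sends to [open_cut u], inequalities being reversed there; the
    equator is negligible. *)
Lemma prob_halfspace0 u : prob P S_zero = 0 -> u != 0%R ->
  prob P (halfspace0 u) =
  prob P S_neg + (P_pos P (cut u) - P_neg P (interior (cut u))).
Proof.
move=> P0 u0; rewrite (interior_cut _ u0) /P_pos /P_neg /prob.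
rewrite trace_S_pos_cut trace_S_neg_open_cut.
set h := trace (halfspace0 u); set s := trace S_neg.
set p := trace [set y | (0 < dot y e_d)%R].
have mh : measurable h by exact: measurable_trace_ge0.
have ms : measurable s by exact: measurable_S_neg.
have mp : measurable p by exact: measurable_trace_gt0.
have mz : measurable (trace S_zero).
  rewrite trace_sphere.
  rewrite (_ : trace _ = ~` (trace [set y | (dot y e_d < 0)%R] `|` p)).
    apply: measurableC; apply: measurableU; last exact: mp.
    exact: measurable_trace_lt0.
  apply/seteqP; split=> y /=; first by rewrite /p /= => ->; rewrite ltxx => -[].
  by move=> /not_orP[/negP y0 /negP y1]; apply/eqP; rewrite eq_le !leNgt y0 y1.
have hs : P (h `\` s) = P (p `&` h).
  have mhs : measurable (h `\` s) by exact: measurableD.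
  (* Off both open hemispheres only the equator is left. *)
  rewrite (measureDI P mhs mp) [X in X + _ = _](_ : _ = 0) ?add0e.
    congr (P _); apply/seteqP; split=> y [].
      by move=> [hy _] py.
    move=> py hy; do 2 split => //; rewrite /s trace_S_neg /=.
    by apply/negP; rewrite -leNgt ltW.
  apply: (subset_measure0 _ mz _ P0); first exact: measurableD.
  move=> y [[_ sy] py]; rewrite trace_sphere /=; apply/eqP.
  rewrite eq_le !leNgt; apply/andP; split; apply/negP; first exact: py.
  by move: sy; rewrite /s trace_S_neg.
have fsh : P (s `\` h) \is a fin_num.
  by apply: fin_num_measure; exact: measurableD.
have -> : P h = P (h `\` s) + P (h `&` s) by exact: measureDI.
have -> : P s = P (s `\` h) + P (h `&` s) by rewrite setIC; exact: measureDI.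
rewrite hs.
by rewrite [RHS]addeCA (addeC (P (s `\` h))) addeK.
Qed.

(** On the lower hemisphere, the boundary of the halfspace of normal [u] is what
    the gnomonic projection sends to the difference between [cut u] and its
    interior. *)
Lemma P_neg_interior_cut u :
  (forall H : set 'rV[R]_n.+1, is_halfspace0 H ->
     prob P (boundary H `&` S_neg) = 0) ->
  sphere R n.+1 u -> P_neg P (interior (cut u)) = P_neg P (cut u).
Proof.
move=> hb su; have u0 := sphere_neq0 _ su.
rewrite (interior_cut _ u0) /P_neg /prob trace_S_neg_open_cut trace_S_neg_cut.
have := hb _ (ex_intro2 _ _ u su erefl).
rewrite /halfspace0 boundary_halfspace// -/(halfspace0 u) /prob preimage_setI.
set s := trace S_neg; set h := trace (halfspace0 u).
set l := trace [set y | (dot y u <= 0)%R]; set b := set_val @^-1` _ => bs0.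
have ms : measurable s by exact: measurable_S_neg.
have mh : measurable h by exact: measurable_trace_ge0.
have msl : measurable (s `&` l).
  by apply: measurableI => //; exact: measurable_trace_le0.
have -> : P (s `&` l) = P ((s `&` l) `\` h) + P ((s `&` l) `&` h).
  exact: measureDI.
have -> : s `&` l `&` h = b `&` s.
  apply/seteqP; split=> y [].
    by move=> [sy ly] hy; split=> //; apply/eqP; rewrite eq_le; apply/andP.
  rewrite /b /= => by0 sy.
  by split; first split=> //; rewrite /l /h /halfspace0 /= by0.
rewrite [X in _ + X]bs0 adde0; congr (P _).
apply/seteqP; split=> y; last by move=> [[]].
move=> [sy hy]; split=> //; split=> //; rewrite /l /=.
by move/negP: hy; rewrite -ltNge => /ltW.
Qed.

Lemma le_P_pos_setT u : P_pos P (cut u) <= P_pos P setT.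
Proof.
rewrite /P_pos /prob; apply: le_measure; last by move=> y [].
- rewrite inE trace_S_pos_cut; apply: measurableI.
    exact: measurable_trace_gt0.
  exact: measurable_trace_ge0.
- by rewrite inE preimage_setT setIT trace_sphere; exact: measurable_trace_gt0.
Qed.

Lemma P_neg_setT : P_neg P setT = prob P S_neg.
Proof. by rewrite /P_neg preimage_setT setIT. Qed.

Lemma cvg_P_neg_cut (w : 'rV[R]_n) :
  P_neg P (cut (lift_halfspace w (- m%:R)%R)) @[m --> \oo] --> P_neg P setT.
Proof.
pose F (m : nat) :=
  trace (S_neg `&` @gnomonic R n @^-1` cut (lift_halfspace w (- m%:R)%R)).
have UF : \bigcup_m F m = trace (S_neg `&` @gnomonic R n @^-1` setT).
  rewrite -preimage_bigcup -setI_bigcupr -preimage_bigcup.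
  by under eq_bigcupr do rewrite cut_lift; rewrite bigcup_halfspace.
rewrite /P_neg /prob -UF; apply: nondecreasing_cvg_mu.
- move=> m; rewrite /F trace_S_neg_cut; apply: measurableI.
    exact: measurable_S_neg.
  exact: measurable_trace_le0.
- by rewrite UF preimage_setT setIT; exact: measurable_S_neg.
- move=> m p mp; apply/subsetPset => y []; rewrite /F !cut_lift /= => sy ym.
  by split=> //=; apply: le_trans ym; rewrite lerN2 ler_nat.
Qed.

(** The whole space contributes nothing new to the infimum of the signed
    depth: it is approached by large closed halfspaces, along which the
    negative part converges while the positive part stays below its total
    mass. This needs a proper halfspace, whence [0 < n]. *)
Lemma hD_le_setT (z : 'rV[R]_n) : (0 < n)%N ->
  hD z (P_pm P) <= P_pos P setT - P_neg P setT.
Proof.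
move=> n0; pose w : 'rV[R]_n := const_mx 1%R.
have w0 : w != 0%R.
  apply/eqP => /rowP/(_ (Ordinal n0)); rewrite !mxE => /eqP.
  by rewrite oner_eq0.
have [m0 _ zm0] : (\bigcup_(m : nat) [set y | (- m%:R <= dot y w)%R]) z.
  by rewrite bigcup_halfspace.
apply: (@cvge_ge _ \oo _ _
  (fun m => P_pos P setT - P_neg P (cut (lift_halfspace w (- m%:R)%R)))).
  exists m0 => //= m m0m.
  have hm : hD z (P_pm P) <= P_pm P (cut (lift_halfspace w (- m%:R)%R)).
    apply: ereal_inf_lbound; exists (cut (lift_halfspace w (- m%:R)%R)) => //.
    rewrite cut_lift; split; first by exists w, (- m%:R)%R.
    by apply: le_trans zm0; rewrite lerN2 ler_nat.
  by apply: le_trans hm _; apply: leeB => //; exact: le_P_pos_setT.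
apply: cvgeB; [|exact: cvg_cst|exact: cvg_P_neg_cut].
by rewrite fin_num_adde_defl// fin_numN P_neg_setT prob_S_neg_fin.
Qed.

End Depth.

Theorem theorem1 (R : realType) (n : nat) (hd : (2 <= n.+1)%N)
    (P : probability (borel (sphere_type R n)) R) (x : 'rV[R]_n.+1)
    (hP0 : prob P S_zero = 0) (hx : S_pos x) :
  ahD P x = prob P S_neg +
    ereal_inf [set P_pos P H - P_neg P (interior H) |
               H in [set H | is_generalized_halfspace H /\ H (gnomonic x)]]
  /\
  ((forall H : set 'rV[R]_n.+1, is_halfspace0 H ->
      prob P (boundary H `&` S_neg) = 0) ->
   ahD P x = prob P S_neg + hD (gnomonic x) (P_pm P)).
Proof.
have [_ x_gt0] := hx.
set I := ereal_inf _.
have ahDE : ahD P x = prob P S_neg + I.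
  rewrite /I -ereal_inf_addl ?prob_S_neg_fin//; congr ereal_inf.
  apply/seteqP; split=> r [].
    move=> u [su ux] <-; exists (cut u).
      by split; [exact: cut_generalized|exact/cut_gnomonic_pos].
    by rewrite prob_halfspace0//; exact: sphere_neq0 su.
  move=> H [/generalized_halfspace_cut[u su ->] xu] <-; exists u.
    by split=> //; exact/(cut_gnomonic_pos _ u x_gt0).
  by rewrite prob_halfspace0//; exact: sphere_neq0 su.
split=> // hb; rewrite ahDE; congr (_ + _).
have P_pmE H : is_generalized_halfspace H ->
    P_pos P H - P_neg P (interior H) = P_pm P H.
  by move=> /generalized_halfspace_cut[u su ->]; rewrite P_neg_interior_cut.
apply/eqP; rewrite eq_le; apply/andP; split.
  apply: le_ereal_inf_tmp => _ [H [hH Hx] <-]; apply: ereal_inf_lbound.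
  by exists H; [split=> //; exact: Or31|apply: P_pmE; exact: Or31].
apply: le_ereal_inf_tmp => _ [H [gH Hx] <-]; rewrite P_pmE//.
case: gH Hx => [hH|->//|->] Hx; last exact: hD_le_setT.
by apply: ereal_inf_lbound; exists H.
Qed.
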